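(* Let $(P,\le)$ be a finite poset that is not a chain. Let $H\subset\mathbb{R}^{\mathcal{A}(P)}$ be the affine subspace $$H=\{f\in\mathbb{R}^{\mathcal{A}(P)} \mid f((x,y))+f((y,x))=1 \text{ for all } (x,y)\in\mathcal{A}(P)\}.$$ Then the probability functions polytope of $P$ is the intersection of the order polytope of $\mathcal{A}(P)$ with $H$: $$\mathcal{Q}_P=\mathcal{O}(\mathcal{A}(P))\cap H .$$
   Context: For $x,y$ in a poset $(P,\le)$, $x\parallel y$ means that neither $x\le y$ nor $y\le x$. A probability function on $P$ is a function $\pi:\{(x,y)\in P\times P\mid x\ne y\}\to[0,1]$ such that, for all $x,y,z\in P$ for which the values involved are defined: (1) $x\le y$ implies $\pi(x,y)=1$; (2) $x\neq y$ implies $\pi(x,y)+\pi(y,x)=1$; (3) $y<z$ implies $\pi(x,y)\le\pi(x,z)$; (4) $y<z$ implies $\pi(z,x)\le\pi(y,x)$. The set $\mathcal{A}(P)=\{(x,y)\in P\times P\mid x\parallel y\}$ is partially ordered by $\preceq_A$, the transitive closure of the relation $\le_A$ defined by: $(x,y)\le_A(u,v)$ iff ($x=u$ and $y\le v$) or ($y=v$ and $u\le x$). The probability functions polytope $\mathcal{Q}_P\subset\mathbb{R}^{\mathcal{A}(P)}\cong\mathbb{R}^{2m}$ (where $2m=|\mathcal{A}(P)|$) is the set of all restrictions $\pi|_{\mathcal{A}(P)}$ of probability functions $\pi$ on $P$ (the values of $\pi$ at comparable pairs being forced). For a finite poset $(Q,\le)$, the order polytope $\mathcal{O}(Q)\subset\mathbb{R}^Q$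 is the set of functions $f:Q\to\mathbb{R}$ with $0\le f(q)\le 1$ for all $q\in Q$ and $f(p)\le f(q)$ whenever $p\le q$ in $Q$. *)

(* Defs.v *)
From HB Require Import structures.
From Stdlib Require Import Relation_Operators.
From mathcomp Require Import all_boot all_order all_algebra.
From mathcomp Require Import classical_sets reals.

Set Implicit Arguments.
Unset Strict Implicit.
Unset Printing Implicit Defensive.

Import Order.TTheory GRing.Theory Num.Theory.
Local Open Scope classical_set_scope.
Local Open Scope ring_scope.

Definition distinct_pair d (P : finPOrderType d) : finType :=
  {p : P * P | p.1 != p.2}.

Definition DistinctPair d (P : finPOrderType d) (x y : P) (xy : x != y) :
  distinct_pair P := exist (fun p : P * P => p.1 != p.2) (x, y) xy.

(* The set A(P); it is a separate type constructor so that it can carry its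
   own order instance. *)
Definition incomp_pair d (P : finPOrderType d) : Type :=
  {p : P * P | (p.1 >< p.2)%O}.

Section IncompPair.
Context {d : Order.disp_t} {P : finPOrderType d}.
Implicit Types p q : incomp_pair P.

HB.instance Definition _ := SubFinite.copy (incomp_pair P)
  {p : P * P | (p.1 >< p.2)%O}.

Fact incomp_pair_neq p : (val p).1 != (val p).2.
Proof. by apply: contraNneq (valP p) => ->; rewrite comparablexx. Qed.

Definition incomp_distinct p : distinct_pair P :=
  DistinctPair (incomp_pair_neq p).

Fact incomp_swap_subproof p : ((val p).2 >< (val p).1)%O.
Proof. by rewrite comparable_sym; exact: valP p. Qed.

Definition incomp_swap p : incomp_pair P :=
  exist (fun q : P * P => (q.1 >< q.2)%O)
    ((val p).2, (val p).1) (incomp_swap_subproof p).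

Definition incomp_step : rel (incomp_pair P) := fun p q =>
  let: (x, y) := val p in let: (u, v) := val q in
  (x == u) && (y <= v)%O || (y == v) && (u <= x)%O.

(* [connect] is the reflexive transitive closure; since [incomp_step] is
   reflexive, this is its transitive closure (see [incomp_leP]). *)
Definition incomp_le : rel (incomp_pair P) := connect incomp_step.

Lemma incomp_step_refl : reflexive incomp_step.
Proof. by move=> [[x y] xy]; rewrite /incomp_step /= eqxx lexx. Qed.

Lemma incomp_leP p q : reflect (clos_trans _ incomp_step p q) (incomp_le p q).
Proof.
apply: (iffP idP) => [/connectP[s]|].
  elim: s p => [|r s IHs] p /= => [_ ->|/andP[pr rs] eq_q].
    by apply: t_step; exact: incomp_step_refl.
  by apply: t_trans (IHs _ rs eq_q); exact: t_step.
by elim=> [? ? /connect1//|? r ? _ pr _]; exact: connect_trans pr.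
Qed.

Fact incomp_le_coord p q : incomp_le p q ->
  ((val q).1 <= (val p).1)%O && ((val p).2 <= (val q).2)%O.
Proof.
move=> /incomp_leP; elim=> {p q} [[[x y] ?] [[u v] ?]|p r q _ + _].
  rewrite /incomp_step /= => /orP[]/andP[/eqP->].
    by rewrite lexx.
  by rewrite lexx andbT.
move=> /andP[rp pr] /andP[qr rq].
by rewrite (le_trans qr rp) (le_trans pr rq).
Qed.

Fact incomp_le_anti : antisymmetric incomp_le.
Proof.
move=> p q /andP[/incomp_le_coord/andP[qp1 pq2] /incomp_le_coord/andP[pq1 qp2]].
apply/val_inj/eqP; rewrite -pair_eqE /pair_eq /=.
by rewrite !eq_le qp1 pq2 pq1 qp2.
Qed.

Fact incomp_display : Order.disp_t. Proof. exact: Order.Disp tt tt. Qed.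

HB.instance Definition _ := Order.Le_isPOrder.Build incomp_display
  (incomp_pair P) (connect0 incomp_step) incomp_le_anti
  (@connect_trans _ incomp_step).

End IncompPair.

Lemma incomp_pair_leE d (P : finPOrderType d) (p q : incomp_pair P) :
  (p <= q)%O = incomp_le p q.
Proof. by []. Qed.

Definition order_polytope (R : realType) d (Q : finPOrderType d) :
    set {ffun Q -> R} :=
  [set f : {ffun Q -> R} | (forall q : Q, 0 <= f q <= 1) /\
           (forall p q : Q, (p <= q)%O -> f p <= f q)].

(* The proof arguments of [DistinctPair] express that the values involved are
   defined. *)
Record probability_function (R : realType) d (P : finPOrderType d)
    (pi : {ffun distinct_pair P -> R}) : Prop := ProbabilityFunction {
  probability_function01 : forall p, 0 <= pi p <= 1 ;
  probability_function_le : forall (x y : P) (xy : x != y),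
    (x <= y)%O -> pi (DistinctPair xy) = 1 ;
  probability_functionC : forall (x y : P) (xy : x != y) (yx : y != x),
    pi (DistinctPair xy) + pi (DistinctPair yx) = 1 ;
  probability_function_homo : forall (x y z : P) (xy : x != y) (xz : x != z),
    (y < z)%O -> pi (DistinctPair xy) <= pi (DistinctPair xz) ;
  probability_function_anti : forall (x y z : P) (zx : z != x) (yx : y != x),
    (y < z)%O -> pi (DistinctPair zx) <= pi (DistinctPair yx)
}.

Definition incomp_restrict (R : realType) d (P : finPOrderType d)
    (pi : {ffun distinct_pair P -> R}) : {ffun incomp_pair P -> R} :=
  [ffun p => pi (incomp_distinct p)].

Definition probability_functions_polytope (R : realType) d
    (P : finPOrderType d) : set {ffun incomp_pair P -> R} :=
  [set incomp_restrict pi |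
    pi in [set pi : {ffun distinct_pair P -> R} | probability_function pi]].

Definition swap_sum1 (R : realType) d (P : finPOrderType d) :
    set {ffun incomp_pair P -> R} :=
  [set f : {ffun incomp_pair P -> R} | forall p, f p + f (incomp_swap p) = 1].

Arguments order_polytope R {d} Q _.
Arguments probability_functions_polytope R {d} P _.
Arguments swap_sum1 R {d} P _.

(* Main.v *)
(** The order on A(P) is generated by the steps [(x, y) <= (x, v)] for [y <= v]
    and [(x, y) <= (u, y)] for [u <= x], so monotonicity on A(P) is conditions
    (3) and (4) restricted to incomparable pairs.  Conversely, a point [f] of
    the right-hand side is extended by the forced values 0 and 1 on comparable
    pairs; in (3) the mixed cases hold because if [y < z] and exactly one of
    [y], [z] is incomparable to [x], then [pi (x, y) = 0] or [pi (x, z) = 1].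
    Condition (4) follows from (2) and (3). *)
Require Import Defs.
From mathcomp Require Import all_boot all_order all_algebra.
From mathcomp Require Import classical_sets reals.

Local Open Scope classical_set_scope.

Import Order.TTheory GRing.Theory Num.Theory.

Section Extension.
Local Open Scope ring_scope.
Context {R : realType} {d : Order.disp_t} {P : finPOrderType d}.
Implicit Types (pi : {ffun distinct_pair P -> R}) (f : {ffun incomp_pair P -> R}).

(** Total on [P * P], so no proofs of distinctness are carried around; the diagonal gets the value
    1, which keeps monotonicity in the second argument valid there too. *)
Definition incomp_extend f (x y : P) : R :=
  if insub (x, y) is Some p then f p else (x <= y)%O%:R.

Lemma incomp_extendE f (p : incomp_pair P) :
  incomp_extend f (val p).1 (val p).2 = f p.
Proof. by rewrite /incomp_extend -surjective_pairing valK. Qed.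

Lemma incomp_extend_comparable f (x y : P) :
  (x >=< y)%O -> incomp_extend f x y = (x <= y)%O%:R.
Proof. by move=> xy; rewrite /incomp_extend insubF //= xy. Qed.

Lemma incomp_extend01 f (x y : P) :
  (forall p, 0 <= f p <= 1) -> 0 <= incomp_extend f x y <= 1.
Proof.
by move=> f01; rewrite /incomp_extend; case: insub => //; rewrite ler0n lern1 leq_b1.
Qed.

Lemma incomp_extendC f (x y : P) : swap_sum1 R P f -> x != y ->
  incomp_extend f x y + incomp_extend f y x = 1.
Proof.
move=> fC xy; have [cxy|ixy] := boolP (x >=< y)%O.
  have cyx : (y >=< x)%O by rewrite comparable_sym.
  rewrite !incomp_extend_comparable //.
  (* As [x != y], exactly one of the two indicators is 1. *)
  by case: (comparable_ltgtP cxy) xy => // _ _; rewrite ?addr0 ?add0r.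
pose p : incomp_pair P := exist (fun q : P * P => (q.1 >< q.2)%O) (x, y) ixy.
by rewrite (incomp_extendE f p) (incomp_extendE f (incomp_swap p)) fC.
Qed.

Lemma incomp_extend_homo f (x y z : P) : order_polytope R (incomp_pair P) f ->
  (y < z)%O -> incomp_extend f x y <= incomp_extend f x z.
Proof.
move=> [f01 f_homo] yz.
have /andP[ge0 _] := incomp_extend01 f x z f01.
have /andP[_ le1] := incomp_extend01 f x y f01.
(* If [x <= z], the right side is 1. *)
have [xz|nxz] := boolP (x <= z)%O.
  by rewrite [leRHS]incomp_extend_comparable ?xz // /Order.comparable xz.
have nxy : (x <= y)%O = false.
  by apply: contraNF nxz => /le_trans; apply; exact: ltW.
(* If [y <= x], the left side is 0; otherwise both pairs are incomparable and form a single step of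
   A(P). *)
have [yx|nyx] := boolP (y <= x)%O.
  by rewrite incomp_extend_comparable ?nxy // /Order.comparable yx orbT.
have nzx : ~~ (z <= x)%O by apply: contraNN nyx => /(le_trans (ltW yz)).
have ixy : (x >< y)%O by rewrite /Order.comparable nxy (negPf nyx).
have ixz : (x >< z)%O by rewrite /Order.comparable negb_or nxz.
pose p : incomp_pair P := exist (fun q : P * P => (q.1 >< q.2)%O) (x, y) ixy.
pose q : incomp_pair P := exist (fun q : P * P => (q.1 >< q.2)%O) (x, z) ixz.
rewrite (incomp_extendE f p) (incomp_extendE f q) f_homo// incomp_pair_leE.
by apply: connect1; rewrite /incomp_step /= eqxx ltW.
Qed.

Lemma incomp_extend_probability f :
  order_polytope R (incomp_pair P) f -> swap_sum1 R P f ->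
  probability_function
    [ffun p : distinct_pair P => incomp_extend f (val p).1 (val p).2].
Proof.
move=> fO fC; split=> [p|x y xy le_xy|x y xy yx|x y z xy xz yz|x y z zx yx yz];
  rewrite !ffunE /=.
- by apply: incomp_extend01; case: fO.
- by rewrite incomp_extend_comparable ?le_xy // /Order.comparable le_xy.
- exact: incomp_extendC.
- exact: incomp_extend_homo.
(* Complementing both sides to 1 swaps the arguments and reverses the inequality. *)
- have /(canRL (addrK _)) -> := incomp_extendC _ _ _ fC zx.
  have /(canRL (addrK _)) -> := incomp_extendC _ _ _ fC yx.
  by rewrite lerD2l lerN2 incomp_extend_homo.
Qed.

Lemma incomp_restrict_step pi (p q : incomp_pair P) :
  probability_function pi -> incomp_step p q ->
  incomp_restrict pi p <= incomp_restrict pi q.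
Proof.
case: p q => [[x y] xy] [[u v] uv] piP; rewrite /incomp_step !ffunE /=.
(* Steps are weak but (3) and (4) are strict: in the equality cases [p] and [q] differ only in their
   proofs of incomparability. *)
case/orP => /andP[/eqP eqxu]; rewrite le_eqVlt => /predU1P[eqyv|lt].
- by subst u v; rewrite (bool_irrelevance xy uv).
- by subst u; exact: probability_function_homo piP _ _ _ _ _ lt.
- by subst u v; rewrite (bool_irrelevance xy uv).
- by subst v; exact: probability_function_anti piP _ _ _ _ _ lt.
Qed.

Lemma incomp_restrict_order_polytope pi :
  probability_function pi ->
  order_polytope R (incomp_pair P) (incomp_restrict pi).
Proof.
move=> piP; split=> [p|p q].
  by rewrite ffunE; exact: probability_function01.
(* Monotonicity along single steps passes to their transitive closure. *)
rewrite incomp_pair_leE => /incomp_leP; elim=> [{}p {}q|{}p r {}q _ + _].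
  exact: incomp_restrict_step.
exact: le_trans.
Qed.

Lemma incomp_restrict_swap_sum1 pi :
  probability_function pi -> swap_sum1 R P (incomp_restrict pi).
Proof. by move=> piP p; rewrite !ffunE; exact: probability_functionC. Qed.

End Extension.

Theorem theorem4p16 (R : realType) (d : Order.disp_t) (P : finPOrderType d)
    (P_not_chain : ~ total (<=%O : rel P)) :
  probability_functions_polytope R P =
    order_polytope R (incomp_pair P) `&` swap_sum1 R P.
Proof.
apply/seteqP; split=> [_ [pi piP <-]|f [fO fC]].
  split; [exact: incomp_restrict_order_polytope|exact: incomp_restrict_swap_sum1].
exists [ffun p : distinct_pair P => incomp_extend f (val p).1 (val p).2].
  exact: incomp_extend_probability.
by apply/ffunP=> p; rewrite !ffunE /= incomp_extendE.
Qed.
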